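(* Let $\alpha$ be a smooth function of $t$, let $c_1,c_2,b,d$ be arbitrary constants with $(c_1,c_2)\neq(0,0)$, let $a$ be a positive constant, and put $$Z=c_1\int e^{-\int\alpha(t)\,dt}\,dt+c_2.$$ Then the function $$u=\frac{\dfrac{105}{16}\,a\,\mathrm{cn}^4\!\left(\dfrac{\sqrt2}{4}a^{\frac14}\left(\dfrac{x+d}{Z}-\dfrac{21}{8}a\displaystyle\int\frac{e^{-\int\alpha(t)\,dt}}{Z^2}\,dt\right)+b;\dfrac{\sqrt2}{2}\right)+c_1(x+d)}{e^{\int\alpha(t)\,dt}\,Z}$$ is an exact solution of the variable coefficient equation $$u_t+uu_x+\alpha(t)u-e^{-\int\alpha(t)\,dt}Z^3u_{xxxxx}=0.$$
   Context: $\mathrm{cn}(z;k)$ is the Jacobi elliptic cosine with modulus $k$ (so $k=\sqrt2/2$ means parameter $m=k^2=1/2$). Integrals denote a fixed choice of antiderivatives, the same choice of $\int\alpha(t)\,dt$ and of $\int e^{-\int\alpha(t)\,dt}dt$ being used throughout; $t$ ranges over an interval where $Z\neq0$. *)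

(* Defs.v *)
From Stdlib Require Import Reals Lra ClassicalEpsilon.
From Coquelicot Require Import Coquelicot.
Open Scope R_scope.

(** ** Jacobi elliptic cosine on the real line, with modulus [k] (parameter [k^2]) *)

Definition elliptic_F (phi k : R) : R :=
  RInt (fun theta => / sqrt (1 - k ^ 2 * sin theta ^ 2)) 0 phi.

(** The amplitude is the inverse of [fun phi => elliptic_F phi k], which for
    [0 <= k < 1] is a bijection of the real line ([elliptic_F_bijective]
    below).  For other moduli the value is unspecified. *)
Definition jacobi_am (z k : R) : R :=
  epsilon (inhabits 0) (fun phi => elliptic_F phi k = z).

Definition jacobi_cn (z k : R) : R := cos (jacobi_am z k).

Lemma elliptic_F_integrand_pos (k theta : R) :
  0 <= k < 1 -> 0 < 1 - k ^ 2 * sin theta ^ 2 <= 1.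
Proof.
intros Hk.
assert (Hs : 0 <= sin theta ^ 2 <= 1).
{ generalize (sin2_cos2 theta); unfold Rsqr; intros; nra. }
assert (Hk2 : 0 <= k ^ 2 < 1) by nra.
nra.
Qed.

Lemma elliptic_F_integrand_continuous (k theta : R) :
  0 <= k < 1 ->
  continuous (fun theta => / sqrt (1 - k ^ 2 * sin theta ^ 2)) theta.
Proof.
intros Hk.
destruct (elliptic_F_integrand_pos k theta Hk) as [Hp _].
apply (@ex_derive_continuous R_AbsRing R_NormedModule).
auto_derive.
replace (1 + - (k * (k * 1) * (sin theta * (sin theta * 1))))
  with (1 - k ^ 2 * sin theta ^ 2) by ring.
repeat split; try exact Hp.
apply Rgt_not_eq, sqrt_lt_R0, Hp.
Qed.

Lemma is_derive_elliptic_F (k phi : R) :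
  0 <= k < 1 ->
  is_derive (fun phi => elliptic_F phi k) phi
            (/ sqrt (1 - k ^ 2 * sin phi ^ 2)).
Proof.
intros Hk; unfold elliptic_F.
apply (is_derive_RInt (fun theta => / sqrt (1 - k ^ 2 * sin theta ^ 2)) _ 0).
- apply filter_forall; intros y.
  apply (@RInt_correct R_CompleteNormedModule), (@ex_RInt_continuous R_CompleteNormedModule).
  intros z _; apply elliptic_F_integrand_continuous, Hk.
- apply elliptic_F_integrand_continuous, Hk.
Qed.

Lemma elliptic_F_continuous (k phi : R) :
  0 <= k < 1 -> continuity_pt (fun phi => elliptic_F phi k) phi.
Proof.
intros Hk; apply continuity_pt_filterlim.
apply (@ex_derive_continuous R_AbsRing R_NormedModule (fun phi => elliptic_F phi k)).
eexists; apply is_derive_elliptic_F, Hk.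
Qed.

Lemma elliptic_F_expansive (k x y : R) :
  0 <= k < 1 -> x <= y -> y - x <= elliptic_F y k - elliptic_F x k.
Proof.
intros Hk Hxy.
destruct (MVT_gen (fun phi => elliptic_F phi k) x y
           (fun phi => / sqrt (1 - k ^ 2 * sin phi ^ 2))) as [c [_ Hc]].
- intros; apply is_derive_elliptic_F, Hk.
- intros; apply elliptic_F_continuous, Hk.
- rewrite Hc.
  destruct (elliptic_F_integrand_pos k c Hk) as [Hp Hp1].
  assert (H1 : 0 < sqrt (1 - k ^ 2 * sin c ^ 2)) by now apply sqrt_lt_R0.
  assert (H2 : sqrt (1 - k ^ 2 * sin c ^ 2) <= 1)
    by (generalize (sqrt_le_1_alt _ _ Hp1); now rewrite sqrt_1).
  assert (H3 : 1 <= / sqrt (1 - k ^ 2 * sin c ^ 2))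
    by (generalize (Rinv_le_contravar _ _ H1 H2); now rewrite Rinv_1).
  nra.
Qed.

Lemma elliptic_F_bijective (k z : R) :
  0 <= k < 1 -> exists! phi : R, elliptic_F phi k = z.
Proof.
intros Hk.
assert (H0 : elliptic_F 0 k = 0) by (unfold elliptic_F; apply (@RInt_point R_CompleteNormedModule)).
assert (Hz : 0 <= Rabs z) by apply Rabs_pos.
assert (Hz' : - Rabs z <= z <= Rabs z) by (split_Rabs; lra).
destruct (IVT_gen (fun phi => elliptic_F phi k) (- Rabs z) (Rabs z) z)
  as [phi [_ Hphi]].
- intros y; apply elliptic_F_continuous, Hk.
- generalize (elliptic_F_expansive k (- Rabs z) 0 Hk ltac:(lra)).
  generalize (elliptic_F_expansive k 0 (Rabs z) Hk ltac:(lra)).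
  intros; unfold Rmin, Rmax; destruct Rle_dec; lra.
- exists phi; split; [exact Hphi|].
  intros psi Hpsi.
  destruct (Rle_dec phi psi) as [H|H].
  + generalize (elliptic_F_expansive k phi psi Hk H); lra.
  + generalize (elliptic_F_expansive k psi phi Hk ltac:(lra)); lra.
Qed.

Lemma jacobi_am_spec (z k : R) :
  0 <= k < 1 -> elliptic_F (jacobi_am z k) k = z.
Proof.
intros Hk; apply (epsilon_spec (inhabits 0) (fun phi => elliptic_F phi k = z)).
destruct (elliptic_F_bijective k z Hk) as [phi [Hphi _]].
now exists phi.
Qed.

(** ** Functions on the open interval [(lo, hi)], possibly unbounded *)

Definition in_oo (lo hi : Rbar) (t : R) : Prop := Rbar_lt lo t /\ Rbar_lt t hi.

Definition smooth_on (lo hi : Rbar) (f : R -> R) : Prop :=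
  forall (n : nat) (t : R), in_oo lo hi t -> ex_derive_n f n t.

Definition antiderivative_on (lo hi : Rbar) (f F : R -> R) : Prop :=
  forall t : R, in_oo lo hi t -> is_derive F t (f t).

(* Main.v *)
Require Import Defs.
From Stdlib Require Import Reals Lra Lia.
From Coquelicot Require Import Coquelicot.
Open Scope R_scope.

(** With [g = 105/16 a cn^4] a function of the similarity variable
    [xi = (x + d) / Z - 21/8 a W], the terms in [alpha] and [c1] cancel and the
    equation reduces to [g^(5) = (g - 21/8 a) g'].  For modulus [sqrt 2 / 2] the
    function [y = cn] satisfies [y'^2 = (1 - y^4) / 2] and [y'' = - y^3], so
    [(y^4)'''' = 6 - 168 y^4 + 210 y^8]; one more differentiation and the choice
    of the frequency [sqrt 2 / 4 * a^(1/4)], whose fourth power is [a / 64],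
    give the reduced equation. *)

(** * Differentiability of the Jacobi amplitude *)

(** The mean value theorem for [elliptic_F] between the two amplitudes, solved for their difference.
    The root is at most 1, so the amplitude is 1-Lipschitz; this keeps [c] close to
    [jacobi_am z k]. *)
Lemma jacobi_am_increment (k z w : R) :
  0 <= k < 1 ->
  exists c, Rabs (c - jacobi_am z k) <= Rabs (w - z) /\
    jacobi_am w k - jacobi_am z k = sqrt (1 - k ^ 2 * sin c ^ 2) * (w - z).
Proof.
intros Hk.
destruct (MVT_gen (fun phi => elliptic_F phi k) (jacobi_am z k) (jacobi_am w k)
           (fun phi => / sqrt (1 - k ^ 2 * sin phi ^ 2))) as [c [Hc He]].
- intros; apply is_derive_elliptic_F, Hk.
- intros; apply elliptic_F_continuous, Hk.
- rewrite !jacobi_am_spec in He by exact Hk.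
  destruct (elliptic_F_integrand_pos k c Hk) as [Hp Hp1].
  assert (H1 : 0 < sqrt (1 - k ^ 2 * sin c ^ 2)) by now apply sqrt_lt_R0.
  assert (Heq : jacobi_am w k - jacobi_am z k
                = sqrt (1 - k ^ 2 * sin c ^ 2) * (w - z)).
  { rewrite He; field; lra. }
  exists c; split; [|exact Heq].
  assert (H2 : sqrt (1 - k ^ 2 * sin c ^ 2) <= 1)
    by (generalize (sqrt_le_1_alt _ _ Hp1); now rewrite sqrt_1).
  apply Rle_trans with (Rabs (jacobi_am w k - jacobi_am z k)).
  + revert Hc; unfold Rmin, Rmax; destruct Rle_dec; split_Rabs; lra.
  + rewrite Heq, Rabs_mult, (Rabs_pos_eq (sqrt _)) by lra.
    generalize (Rabs_pos (w - z)); nra.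
Qed.

Lemma is_derive_jacobi_am (k z : R) :
  0 <= k < 1 ->
  is_derive (fun z => jacobi_am z k) z
            (sqrt (1 - k ^ 2 * sin (jacobi_am z k) ^ 2)).
Proof.
intros Hk.
assert (Hcont : continuity_pt (fun th => sqrt (1 - k ^ 2 * sin th ^ 2))
                              (jacobi_am z k)).
{ apply continuity_pt_filterlim.
  apply (@ex_derive_continuous R_AbsRing R_NormedModule
           (fun th => sqrt (1 - k ^ 2 * sin th ^ 2))).
  auto_derive.
  generalize (elliptic_F_integrand_pos k (jacobi_am z k) Hk); simpl.
  intros; lra. }
apply is_derive_Reals; intros eps Heps.
destruct (Hcont eps Heps) as [del [Hdel Hd]].
exists (mkposreal del Hdel); intros h Hh Hhd; simpl in Hhd.
destruct (jacobi_am_increment k z (z + h) Hk) as [c [Hc He]].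
replace (z + h - z) with h in Hc, He by ring.
rewrite He.
replace (sqrt (1 - k ^ 2 * sin c ^ 2) * h / h)
  with (sqrt (1 - k ^ 2 * sin c ^ 2)) by (field; exact Hh).
(* The difference quotient is the root at [c], so continuity of the root finishes; [continuity_pt]
   only speaks of points other than the centre, hence the separate case. *)
destruct (Req_dec c (jacobi_am z k)) as [->|Hn].
- rewrite Rminus_diag, Rabs_R0; exact Heps.
- apply (Hd c); split.
  + split; [exact I|now apply not_eq_sym].
  + simpl; unfold Rdist; lra.
Qed.

(** * First and second derivatives of cn *)

(** This is [- sn * dn], with sn the sine of the amplitude and dn the square root. *)
Definition jacobi_cn_prime (z k : R) : R :=
  - sin (jacobi_am z k) * sqrt (1 - k ^ 2 * sin (jacobi_am z k) ^ 2).

Lemma is_derive_jacobi_cn (k z : R) :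
  0 <= k < 1 ->
  is_derive (fun z => jacobi_cn z k) z (jacobi_cn_prime z k).
Proof.
intros Hk; unfold jacobi_cn, jacobi_cn_prime.
generalize (is_derive_jacobi_am k z Hk); intros Ham.
auto_derive; [eexists; eassumption|].
rewrite (is_derive_unique (fun z : R => jacobi_am z k) _ _ Ham); ring.
Qed.

(** At [k ^ 2 = 1 / 2] the linear term vanishes, leaving [y'' = - y^3]. *)
Lemma is_derive_jacobi_cn_prime (k z : R) :
  0 <= k < 1 ->
  is_derive (fun z => jacobi_cn_prime z k) z
            ((2 * k ^ 2 - 1) * jacobi_cn z k - 2 * k ^ 2 * jacobi_cn z k ^ 3).
Proof.
intros Hk; unfold jacobi_cn, jacobi_cn_prime.
generalize (is_derive_jacobi_am k z Hk); intros Ham.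
destruct (elliptic_F_integrand_pos k (jacobi_am z k) Hk) as [Hp _].
auto_derive.
- simpl in Hp; repeat split; try (eexists; eassumption); lra.
- rewrite (is_derive_unique (fun z : R => jacobi_am z k) _ _ Ham).
  set (s := sin (jacobi_am z k)) in *; set (c := cos (jacobi_am z k)).
  assert (Hsc : s ^ 2 = 1 - c ^ 2).
  { generalize (sin2_cos2 (jacobi_am z k)); unfold Rsqr, s, c; lra. }
  replace (1 + - (k * (k * 1) * (s * (s * 1)))) with (1 - k ^ 2 * s ^ 2) by ring.
  assert (H1 : 0 < sqrt (1 - k ^ 2 * s ^ 2)) by now apply sqrt_lt_R0.
  assert (H2 : sqrt (1 - k ^ 2 * s ^ 2) ^ 2 = 1 - k ^ 2 * s ^ 2)
    by (apply pow2_sqrt; lra).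
  set (r := sqrt (1 - k ^ 2 * s ^ 2)) in *.
  (* The factor [r] of the derivative of the amplitude cancels the [/ r] that comes from
     differentiating the root. *)
  transitivity (- c * r ^ 2 + k ^ 2 * s ^ 2 * c).
  + field; lra.
  + rewrite H2, Hsc; ring.
Qed.

Lemma jacobi_cn_prime_sqr (k z : R) :
  0 <= k < 1 ->
  jacobi_cn_prime z k ^ 2
  = (1 - jacobi_cn z k ^ 2) * (1 - k ^ 2 + k ^ 2 * jacobi_cn z k ^ 2).
Proof.
intros Hk; unfold jacobi_cn, jacobi_cn_prime.
destruct (elliptic_F_integrand_pos k (jacobi_am z k) Hk) as [Hp _].
rewrite Rpow_mult_distr, pow2_sqrt by lra.
assert (Hsc : sin (jacobi_am z k) ^ 2 = 1 - cos (jacobi_am z k) ^ 2).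
{ generalize (sin2_cos2 (jacobi_am z k)); unfold Rsqr; lra. }
replace ((- sin (jacobi_am z k)) ^ 2) with (sin (jacobi_am z k) ^ 2) by ring.
rewrite Hsc; ring.
Qed.

(** * Space derivatives of the quartic profile *)

(** The [n]-th derivative of [y ^ 4], [n <= 5], as a polynomial in [y] and
    [q = y'], for a solution of [y'' = - y^3] with [q^2 = (1 - y^4) / 2]. *)
Definition quartic_deriv (n : nat) (y q : R) : R :=
  match n with
  | 0 => y ^ 4
  | 1 => 4 * y ^ 3 * q
  | 2 => 6 * y ^ 2 - 10 * y ^ 6
  | 3 => (12 * y - 60 * y ^ 5) * q
  | 4 => 6 - 168 * y ^ 4 + 210 * y ^ 8
  | _ => (1680 * y ^ 7 - 672 * y ^ 3) * q
  end.

(** Even orders are polynomials in [y] alone, so the chain rule suffices. Odd orders are linear in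
    [q]; their derivatives contain [q ^ 2], which the first integral eliminates. *)
Lemma is_derive_quartic_deriv (y q : R -> R) (n : nat) (z : R) :
  (n < 5)%nat ->
  is_derive y z (q z) -> is_derive q z (- y z ^ 3) ->
  q z ^ 2 = (1 - y z ^ 4) / 2 ->
  is_derive (fun s => quartic_deriv n (y s) (q s)) z
            (quartic_deriv (S n) (y z) (q z)).
Proof.
intros Hn Hy Hq Hyq.
destruct n as [|[|[|[|[|n]]]]]; [| | | | |lia]; simpl quartic_deriv;
  (auto_derive; [repeat split; eexists; eassumption|]);
  rewrite ?(is_derive_unique (fun x : R => y x) _ _ Hy),
    ?(is_derive_unique (fun x : R => q x) _ _ Hq).
- ring.
- transitivity (12 * y z ^ 2 * q z ^ 2 - 4 * y z ^ 6); [ring|].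
  rewrite Hyq; field.
- ring.
- transitivity ((12 - 300 * y z ^ 4) * q z ^ 2
                - (12 * y z - 60 * y z ^ 5) * y z ^ 3); [ring|].
  rewrite Hyq; field.
- ring.
Qed.

Lemma Derive_n_chain (f : nat -> R -> R) (N : nat) :
  (forall n x, (n < N)%nat -> is_derive (f n) x (f (S n) x)) ->
  forall n x, (n <= N)%nat ->
    ex_derive_n (f 0%nat) n x /\ Derive_n (f 0%nat) n x = f n x.
Proof.
intros Hf; induction n as [|n IH]; intros x Hn; [now split|].
assert (H : is_derive (Derive_n (f 0%nat) n) x (f (S n) x)).
{ apply is_derive_ext with (f n); [|apply Hf; lia].
  intros s; symmetry; apply IH; lia. }
split; [eexists; eassumption|now apply is_derive_unique].
Qed.

(** For fixed [t] the solution has this form in [x]: the phase is affine with slope [l], and the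
    denominator is a constant [C]. The term [c1 * (x + d)] survives only in orders 0 and 1. *)
Lemma quartic_profile_derive_n (y q : R -> R) (B C c1 d l m : R)
    (n : nat) (x : R) :
  (forall z, is_derive y z (q z)) -> (forall z, is_derive q z (- y z ^ 3)) ->
  (forall z, q z ^ 2 = (1 - y z ^ 4) / 2) ->
  C <> 0 -> (n <= 5)%nat ->
  let f := fun x => (B * y (l * x + m) ^ 4 + c1 * (x + d)) / C in
  ex_derive_n f n x /\
  Derive_n f n x
  = (B * l ^ n * quartic_deriv n (y (l * x + m)) (q (l * x + m))
     + match n with 0 => c1 * (x + d) | 1 => c1 | _ => 0 end) / C.
Proof.
intros Hy Hq Hyq HC Hn f.
set (F := fun n x =>
  (B * l ^ n * quartic_deriv n (y (l * x + m)) (q (l * x + m))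
     + match n with 0 => c1 * (x + d) | 1 => c1 | _ => 0 end) / C).
assert (HF : forall x, F 0%nat x = f x)
  by (intros s; unfold F, f; simpl; now rewrite Rmult_1_r).
destruct (Derive_n_chain F 5) with n x as [H1 H2]; [|exact Hn|].
- clear n x Hn; intros n x Hn.
  generalize (is_derive_quartic_deriv y q n (l * x + m) Hn (Hy _) (Hq _) (Hyq _)).
  intros HD.
  unfold F.
  set (Q := fun s => quartic_deriv n (y s) (q s)) in HD.
  apply is_derive_ext with (fun x => (B * l ^ n * Q (l * x + m)
     + match n with 0 => c1 * (x + d) | 1 => c1 | _ => 0 end) / C);
    [reflexivity|].
  assert (HM : is_derive
     (fun x => match n with 0 => c1 * (x + d) | 1 => c1 | _ => 0 end) x
     (match S n with 0 => c1 * (x + d) | 1 => c1 | _ => 0 end)).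
  { destruct n as [|[|n]]; auto_derive; try exact I; ring. }
  set (M := fun x => match n with 0 => c1 * (x + d) | 1 => c1 | _ => 0 end) in HM.
  apply is_derive_ext with (fun x => (B * l ^ n * Q (l * x + m) + M x) / C);
    [reflexivity|].
  auto_derive; [repeat split; try (eexists; eassumption); exact HC|].
  rewrite (is_derive_unique (fun x : R => Q x) _ _ HD),
    (is_derive_unique (fun x : R => M x) _ _ HM).
  simpl pow; destruct n as [|n]; unfold Rdiv; ring.
- split.
  + now apply ex_derive_n_ext with (F 0%nat).
  + rewrite <- (Derive_n_ext (F 0%nat)) by exact HF; exact H2.
Qed.

(** * The frequency and the verification of the equation *)

Lemma wave_number_pow4 (a : R) :
  0 < a -> (sqrt 2 / 4 * Rpower a (1 / 4)) ^ 4 = a / 64.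
Proof.
intros Ha; rewrite Rpow_mult_distr.
rewrite <- (Rpower_pow 4 (Rpower _ _)) by (unfold Rpower; apply exp_pos).
rewrite Rpower_mult; replace (1 / 4 * INR 4) with 1 by (simpl; field).
rewrite Rpower_1 by exact Ha.
replace ((sqrt 2 / 4) ^ 4) with ((sqrt 2 * sqrt 2) ^ 2 / 256) by field.
rewrite sqrt_sqrt by lra; field.
Qed.

(* A, E and W are the chosen antiderivatives of alpha, exp (- A) and
   exp (- A) / Z ^ 2 on the interval (lo, hi). *)
Theorem mainTheorem7 (lo hi : Rbar) (alpha A E W : R -> R) (a b c1 c2 d : R) :
  let Z := fun t : R => c1 * E t + c2 in
  let u := fun t x : R =>
    (105 / 16 * a *
       jacobi_cn (sqrt 2 / 4 * Rpower a (1 / 4) *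
                    ((x + d) / Z t - 21 / 8 * a * W t) + b)
                 (sqrt 2 / 2) ^ 4
     + c1 * (x + d))
    / (exp (A t) * Z t) in
  smooth_on lo hi alpha ->
  (c1, c2) <> (0, 0) ->
  0 < a ->
  antiderivative_on lo hi alpha A ->
  antiderivative_on lo hi (fun t => exp (- A t)) E ->
  (forall t : R, in_oo lo hi t -> Z t <> 0) ->
  antiderivative_on lo hi (fun t => exp (- A t) / Z t ^ 2) W ->
  forall t x : R, in_oo lo hi t ->
    ex_derive (fun s => u s x) t /\
    (forall n : nat, (n <= 5)%nat -> ex_derive_n (fun y => u t y) n x) /\
    Derive (fun s => u s x) t
      + u t x * Derive (fun y => u t y) x
      + alpha t * u t x
      - exp (- A t) * Z t ^ 3 * Derive_n (fun y => u t y) 5 x = 0.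
Proof.
intros Z u _ _ Ha HA HE HZ HW t x Ht.
assert (Hk2 : (sqrt 2 / 2) ^ 2 = 1 / 2).
{ replace ((sqrt 2 / 2) ^ 2) with (sqrt 2 * sqrt 2 / 4) by field.
  rewrite sqrt_sqrt by lra; field. }
assert (Hk : 0 <= sqrt 2 / 2 < 1).
{ generalize (sqrt_pos 2); intros; split; [lra|nra]. }
set (kap := sqrt 2 / 4 * Rpower a (1 / 4)) in *.
assert (Hkap : kap ^ 4 = a / 64) by now apply wave_number_pow4.
set (y := fun z => jacobi_cn z (sqrt 2 / 2)).
set (q := fun z => jacobi_cn_prime z (sqrt 2 / 2)).
assert (Hy : forall z, is_derive y z (q z))
  by (intros z; now apply is_derive_jacobi_cn).
assert (Hq : forall z, is_derive q z (- y z ^ 3)).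
{ intros z; generalize (is_derive_jacobi_cn_prime (sqrt 2 / 2) z Hk).
  rewrite Hk2; fold (y z).
  replace (- y z ^ 3) with ((2 * (1 / 2) - 1) * y z - 2 * (1 / 2) * y z ^ 3)
    by field; exact (fun H => H). }
assert (Hyq : forall z, q z ^ 2 = (1 - y z ^ 4) / 2).
{ intros z; unfold q; rewrite jacobi_cn_prime_sqr by exact Hk.
  rewrite Hk2; fold (y z); field. }
specialize (HA t Ht); specialize (HE t Ht); specialize (HW t Ht).
specialize (HZ t Ht).
assert (HeA : 0 < exp (A t)) by apply exp_pos.
assert (HeZ : exp (A t) * Z t <> 0)
  by (apply Rmult_integral_contrapositive_currified; lra).
(* [th] is the phase at [(t, x)]; [l * s + m] is the phase at [(t, s)], written as an affine
   function of [s]. *)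
set (th := kap * ((x + d) / Z t - 21 / 8 * a * W t) + b).
set (l := kap / Z t); set (m := kap * (d / Z t - 21 / 8 * a * W t) + b).
assert (Hth : forall s, l * s + m = kap * ((s + d) / Z t - 21 / 8 * a * W t) + b)
  by (intros s; unfold l, m; field; exact HZ).
set (B := 105 / 16 * a).
assert (Hux : forall n, (n <= 5)%nat ->
  ex_derive_n (fun s => u t s) n x /\
  Derive_n (fun s => u t s) n x
  = (B * l ^ n * quartic_deriv n (y th) (q th)
     + match n with 0 => c1 * (x + d) | 1 => c1 | _ => 0 end)
    / (exp (A t) * Z t)).
{ intros n Hn.
  destruct (quartic_profile_derive_n y q B (exp (A t) * Z t) c1 d l m n x
              Hy Hq Hyq HeZ Hn) as [H1 H2].
  assert (Hext : forall s,
    (B * y (l * s + m) ^ 4 + c1 * (s + d)) / (exp (A t) * Z t) = u t s)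
    by (intros s; rewrite Hth; reflexivity).
  rewrite Hth in H2; fold th in H2.
  split.
  - revert H1; apply ex_derive_n_ext; exact Hext.
  - rewrite <- H2; symmetry; apply Derive_n_ext; exact Hext. }
assert (HdZ : is_derive Z t (c1 * exp (- A t))).
{ unfold Z; auto_derive; [eexists; eassumption|].
  rewrite (is_derive_unique (fun x : R => E x) _ _ HE); ring. }
(* The first term differentiates the phase, using [Z' = c1 * exp (- A)] and
   [W' = exp (- A) / Z ^ 2]. The second carries the logarithmic derivative of the denominator
   [exp A * Z]. *)
assert (Hut : is_derive (fun s => u s x) t
  (B * (4 * y th ^ 3 * q th)
     * (kap * (- (x + d) * c1 - 21 / 8 * a) * exp (- A t) / Z t ^ 2)
     / (exp (A t) * Z t)
   - u t x * (alpha t + c1 * exp (- A t) / Z t))).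
{ apply is_derive_ext with (fun s =>
    (B * y (kap * ((x + d) / Z s - 21 / 8 * a * W s) + b) ^ 4
     + c1 * (x + d)) / (exp (A s) * Z s)); [reflexivity|].
  replace (u t x) with ((B * y th ^ 4 + c1 * (x + d)) / (exp (A t) * Z t))
    by reflexivity.
  clearbody Z y; clear u Hux.
  auto_derive.
  - repeat split; try (eexists; eassumption); try assumption.
    eexists; apply Hy.
  - change (kap * ((x + d) * / Z t + - (21 / 8 * a * W t)) + b) with th.
    rewrite (is_derive_unique (fun x : R => A x) _ _ HA),
      (is_derive_unique (fun x : R => Z x) _ _ HdZ),
      (is_derive_unique (fun x : R => W x) _ _ HW),
      (is_derive_unique (fun x : R => y x) _ _ (Hy th)), exp_Ropp.
    field; split; lra. }
split; [eexists; eassumption|].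
split; [intros n Hn; now apply Hux|].
rewrite (is_derive_unique (fun s : R => u s x) _ _ Hut).
change (Derive (fun s => u t s) x) with (Derive_n (fun s => u t s) 1 x).
rewrite (proj2 (Hux 1%nat ltac:(lia))), (proj2 (Hux 5%nat ltac:(lia))).
replace (u t x) with ((B * y th ^ 4 + c1 * (x + d)) / (exp (A t) * Z t))
  by reflexivity.
simpl quartic_deriv.
(* Once [kap ^ 4] becomes [a / 64], a single [kap] is common to all remaining terms. The powers
   [y ^ 7] and [y ^ 3] then balance because [1680 / 64 = 4 * 105 / 16] and
   [672 / 64 = 4 * 21 / 8]. *)
replace (l ^ 5) with (kap ^ 4 * kap / Z t ^ 5) by (unfold l; field; exact HZ).
rewrite Hkap, exp_Ropp; unfold B, l.
field; split; lra.
Qed.
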